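(* Let $\kappa_1\in\mathbb C$. On the boundary component $\mathcal B^1_0$, the restricted Hamiltonian vector field of the fifth Painlevé equation is, in the coordinates $(A,P^1_0)$ and $(a,P^1)$ respectively, $$X^V_{\mathcal B^1_0}(A,P^1_0)=-AP^1_0\,\partial_{P^1_0}+A(A+2P^1_0-\kappa_1)\,\partial_A,$$ $$X^V_{\mathcal B^1_0}(a,P^1)=a(-\kappa_1a+2P^1+1)\,\partial_a+P^1(-\kappa_1a+2P^1+2)\,\partial_{P^1}.$$ The residual spectral data at the node, $$(\kappa_1+1)^2+4P^1_0(A+P^1_0-\kappa_1)\qquad\text{and}\qquad(\kappa_1+1)^2-\frac{4P^1\kappa_1}{a}+\frac{4P^1(P^1+1)}{a^2},$$ are first integrals of the respective vector fields, i.e. they are annihilated by them.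
   Context: Put $\rho=\frac{(\kappa_0+\kappa_1-1)^2-\kappa_\infty^2}{4}$ for $\kappa_0,\kappa_1,\kappa_\infty\in\mathbb C$. The Hamiltonian vector field of the fifth Painlevé equation is $X^V=\partial_t+\frac{\partial H^V}{\partial p}\partial_q-\frac{\partial H^V}{\partial q}\partial_p$ with $$H^V=\frac{q(q-1)^2p^2-\big(\kappa_0(q-1)^2+(\kappa_1-1)q(q-1)-tq\big)p+\rho(q-1)}{t}.$$ Coordinates: $\tilde q=q-1$, $A=\frac{t}{q-1}=\frac1a$, $P^1_0=pq(q-1)$, $P^1=\frac{p(q-1)^2}{t}$. The component $\mathcal B^1_0$ lies over the exceptional curve of the blow-up of the $(t,q)$-plane at $(0,1)$; it is $\{\tilde q=0\}$ in the coordinates $(A,\tilde q,P^1_0)$ and $\{t=0\}$ in the coordinates $(t,a,P^1)$. The restricted vector field is the limit of $X^V$, rescaled by a function, written in these coordinates: the limit as $\tilde q\to0$ of $-t\,X^V$ in coordinates $(A,\tilde q,P^1_0)$, and the limit as $t\to0$ of $a\,t\,X^V$ in coordinates $(t,a,P^1)$. The two displayed functions are the residual spectral data at the node of the limit connection, which lives on a nodal curve. *)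

(* Defs.v *)
From HB Require Import structures.
From mathcomp Require Import all_boot all_order all_algebra.
From mathcomp Require Import all_classical all_reals all_analysis.
From mathcomp Require Import complex.
From mathcomp Require Import ring.
Set Implicit Arguments.
Unset Strict Implicit.
Unset Printing Implicit Defensive.
Import Order.TTheory GRing.Theory Num.Theory.
Import numFieldNormedType.Exports.
Local Open Scope classical_set_scope.
Local Open Scope ring_scope.

(* Everything is over a numFieldType K, because R[i] carries its topology and
   normed-module structure only through that interface; K := R[i] is the
   intended instance, and 'D_v f x is then the complex directional derivative. *)

Section PainleveV.
Variable K : numFieldType.
Implicit Types (x y : K * K * K).

Definition rho (kappa0 kappa1 kappa_inf : K) : K :=
  ((kappa0 + kappa1 - 1) ^+ 2 - kappa_inf ^+ 2) / 4.

(* Points of the phase space are triples (t, q, p). *)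
Definition HV (kappa0 kappa1 kappa_inf : K) x : K :=
  let: (t, q, p) := x in
  (q * (q - 1) ^+ 2 * p ^+ 2
   - (kappa0 * (q - 1) ^+ 2 + (kappa1 - 1) * q * (q - 1) - t * q) * p
   + rho kappa0 kappa1 kappa_inf * (q - 1)) / t.

(* A vector field is the triple of its components: the value (u, v, w) is
   u d/dt + v d/dq + w d/dp. *)
Definition XV (kappa0 kappa1 kappa_inf : K) x : K * K * K :=
  (1, 'D_(0, 0, 1) (HV kappa0 kappa1 kappa_inf) x,
   - 'D_(0, 1, 0) (HV kappa0 kappa1 kappa_inf) x).

(* The vector field X in the coordinates y = phi x, where psi is the inverse of
   phi: its components are the derivatives along X of the components of phi. *)
Definition in_coords (phi psi X : K * K * K -> K * K * K) y : K * K * K :=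
  'D_(X (psi y)) phi (psi y).

(* Coordinates (A, q~, P10), defined where t, q and q - 1 do not vanish. *)
Definition chartA x : K * K * K :=
  let: (t, q, p) := x in (t / (q - 1), q - 1, p * q * (q - 1)).
Definition chartA_inv y : K * K * K :=
  let: (A, q', P) := y in (A * q', q' + 1, P / ((q' + 1) * q')).
Definition chartA_dom : set (K * K * K) :=
  [set y | let: (A, q', P) := y in [/\ A != 0, q' != 0 & q' + 1 != 0]].

(* Coordinates (t, a, P1), defined where t and q - 1 do not vanish. *)
Definition charta x : K * K * K :=
  let: (t, q, p) := x in (t, (q - 1) / t, p * (q - 1) ^+ 2 / t).
Definition charta_inv y : K * K * K :=
  let: (t, a, P) := y in (t, a * t + 1, P / (a ^+ 2 * t)).
Definition charta_dom : set (K * K * K) :=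
  [set y | let: (t, a, P) := y in t != 0 /\ a != 0].

Lemma chartA_invK y : chartA_dom y -> chartA (chartA_inv y) = y.
Proof.
case: y => [[A q] P] /= [A0 q0 q10].
by congr (_, _, _); field; rewrite ?q0 ?q10 ?addrK ?q0.
Qed.

Lemma chartAK t q p : t != 0 -> q != 0 -> q - 1 != 0 ->
  chartA_dom (chartA (t, q, p)) /\ chartA_inv (chartA (t, q, p)) = (t, q, p).
Proof.
move=> t0 q0 q10; split=> /=; last first.
  by congr (_, _, _); field; rewrite ?q0 ?q10 ?subrK ?q0.
by split; rewrite ?subrK// mulf_neq0 ?invr_eq0.
Qed.

Lemma charta_invK y : charta_dom y -> charta (charta_inv y) = y.
Proof.
case: y => [[t a] P] /= [t0 a0].
by congr (_, _, _); field; rewrite ?t0 ?a0.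
Qed.

Lemma chartaK t q p : t != 0 -> q - 1 != 0 ->
  charta_dom (charta (t, q, p)) /\ charta_inv (charta (t, q, p)) = (t, q, p).
Proof.
move=> t0 q10; split=> /=; last by congr (_, _, _); field; rewrite ?t0 ?q10.
by split=> //; rewrite mulf_neq0 ?invr_eq0.
Qed.

(* - t X^V in the coordinates (A, q~, P10). *)
Definition XV_A (kappa0 kappa1 kappa_inf : K) : K * K * K -> K * K * K :=
  in_coords chartA chartA_inv
    (fun x => (- x.1.1) *: XV kappa0 kappa1 kappa_inf x).

(* a t X^V in the coordinates (t, a, P1), with a = (q - 1) / t. *)
Definition XV_a (kappa0 kappa1 kappa_inf : K) : K * K * K -> K * K * K :=
  in_coords charta charta_inv
    (fun x => ((x.1.2 - 1) / x.1.1 * x.1.1) *: XV kappa0 kappa1 kappa_inf x).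

(* F extends continuously from dom to the boundary point b, with value v. *)
Definition boundary_limit (dom : set (K * K * K)) (F : K * K * K -> K * K * K)
    (b v : K * K * K) : Prop :=
  F y @[y --> within dom (nbhs b)] --> v.

(* The planar field Y is the restriction of - t X^V to {q~ = 0}: the extended
   field has no q~-component there, and Y is its (A, P10)-part. The limit is
   taken over all points of the chart near (A, 0, P10); it contains the limit
   q~ --> 0 at fixed (A, P10) when A != 0, and it also makes sense at A = 0,
   where the line with fixed (A, P10) lies in {t = 0}. *)
Definition is_restriction_A (kappa0 kappa1 kappa_inf : K)
    (Y : K * K -> K * K) : Prop :=
  forall A P, boundary_limit chartA_dom (XV_A kappa0 kappa1 kappa_inf)
    (A, 0, P) ((Y (A, P)).1, 0, (Y (A, P)).2).

(* Same for a t X^V and {t = 0}, with planar coordinates (a, P1); here the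
   exceptional points are those with a = 0, where q = 1 along the line. *)
Definition is_restriction_a (kappa0 kappa1 kappa_inf : K)
    (Y : K * K -> K * K) : Prop :=
  forall a P, boundary_limit charta_dom (XV_a kappa0 kappa1 kappa_inf)
    (0, a, P) (0, (Y (a, P)).1, (Y (a, P)).2).

(* f is differentiable along Y on D and Y f = 0 there. *)
Definition first_integral (D : set (K * K)) (Y : K * K -> K * K)
    (f : K * K -> K) : Prop :=
  forall z, D z -> is_derive z (Y z) f 0.

(* The displayed vector fields and spectral data on the component B^1_0. *)
Definition XB_A (kappa1 : K) (z : K * K) : K * K :=
  let: (A, P) := z in (A * (A + 2 * P - kappa1), - (A * P)).
Definition XB_a (kappa1 : K) (z : K * K) : K * K :=
  let: (a, P) := z in
  (a * (- kappa1 * a + 2 * P + 1), P * (- kappa1 * a + 2 * P + 2)).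

Definition spectral_A (kappa1 : K) (z : K * K) : K :=
  let: (A, P) := z in (kappa1 + 1) ^+ 2 + 4 * P * (A + P - kappa1).
Definition spectral_a (kappa1 : K) (z : K * K) : K :=
  let: (a, P) := z in
  (kappa1 + 1) ^+ 2 - 4 * P * kappa1 / a + 4 * P * (P + 1) / a ^+ 2.

End PainleveV.

(* Main.v *)
Require Import Defs.
From HB Require Import structures.
From mathcomp Require Import all_boot all_order all_algebra.
From mathcomp Require Import all_classical all_reals all_analysis.
From mathcomp Require Import complex.
From mathcomp Require Import ring.
Import Order.TTheory GRing.Theory Num.Theory.
Import numFieldNormedType.Exports.
Local Open Scope classical_set_scope.
Local Open Scope ring_scope.

(* Away from the boundary, - t X^V in the coordinates (A, q~, P10) and a t X^V in
   the coordinates (t, a, P1) are explicit rational functions of the coordinates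
   whose only denominator, after cancellation, is q = q~ + 1 (in the first
   chart). They therefore extend continuously to the boundary component, and the
   restricted fields are the values of these extensions at q~ = 0 and t = 0. *)

Section DirectionalDerivative.
Context {K : numFieldType} {V : normedModType K}.
Implicit Types (x v : V).

(** The difference quotient of a pair is the pair of difference quotients, and limits in a product
    are taken componentwise. *)
Lemma is_derive_pair {W1 W2 : normedModType K} {x v}
    {f : V -> W1} {g : V -> W2} {df dg} :
  is_derive x v f df -> is_derive x v g dg ->
  is_derive x v (fun y => (f y, g y)) (df, dg).
Proof.
move=> [f1 f2] [g1 g2].
have fg : (fun h : K => h^-1 *: (((fun y => (f y, g y)) \o shift x) (h *: v)
    - (f x, g x))) @ 0^' --> (df, dg).
  (* Writing [df] and [dg] back as the limits that define the derivatives reduces both components to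
     derivability. *)
  by rewrite -f2 -g2; apply: cvg_pair.
by apply: DeriveDef; [apply/cvg_ex; exists (df, dg)|exact: cvg_lim fg].
Qed.

Lemma is_derive_triple {x v} {f g h : V -> K} {df dg dh} :
  is_derive x v f df -> is_derive x v g dg -> is_derive x v h dh ->
  is_derive x v (fun y => (f y, g y, h y)) (df, dg, dh).
Proof.
by move=> fx gx hx; apply: (is_derive_pair (is_derive_pair fx gx) hx).
Qed.

(** A projection is linear and continuous, so it commutes with the difference quotient and with its
    limit. *)
Lemma is_derive_fst {W1 W2 : normedModType K} {x v}
    {f : V -> W1 * W2} {df} :
  is_derive x v f df -> is_derive x v (fun y => (f y).1) df.1.
Proof.
move=> [f1 f2].
have fc : (fun h : K => h^-1 *: (((fun y => (f y).1) \o shift x) (h *: v)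
    - (f x).1)) @ 0^' --> df.1.
  by rewrite -f2; exact: (cvg_comp _ (@fst W1 W2) f1 cvg_fst).
by apply: DeriveDef; [apply/cvg_ex; exists df.1|exact: cvg_lim fc].
Qed.

Lemma is_derive_snd {W1 W2 : normedModType K} {x v}
    {f : V -> W1 * W2} {df} :
  is_derive x v f df -> is_derive x v (fun y => (f y).2) df.2.
Proof.
move=> [f1 f2].
have fc : (fun h : K => h^-1 *: (((fun y => (f y).2) \o shift x) (h *: v)
    - (f x).2)) @ 0^' --> df.2.
  by rewrite -f2; exact: (cvg_comp _ (@snd W1 W2) f1 cvg_snd).
by apply: DeriveDef; [apply/cvg_ex; exists df.2|exact: cvg_lim fc].
Qed.

(* The codomain is K rather than a normed module, and the functions are
   eta-expanded, so that [eapply] can unify the algebraic operations. *)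
Lemma is_derive_addf {x v} {f g : V -> K} {df dg} :
  is_derive x v f df -> is_derive x v g dg ->
  is_derive x v (fun y => f y + g y) (df + dg).
Proof. exact: is_deriveD. Qed.

Lemma is_derive_oppf {x v} {f : V -> K} {df} :
  is_derive x v f df -> is_derive x v (fun y => - f y) (- df).
Proof. exact: is_deriveN. Qed.

Lemma is_derive_mulf {x v} {f g : V -> K} {df dg} :
  is_derive x v f df -> is_derive x v g dg ->
  is_derive x v (fun y => f y * g y) (f x * dg + g x * df).
Proof. exact: is_deriveM. Qed.

Lemma is_derive_expf {x v n} {f : V -> K} {df} :
  is_derive x v f df ->
  is_derive x v (fun y => f y ^+ n) (n%:R * f x ^+ n.-1 * df).
Proof.
move=> fx; have := @is_deriveX _ _ f n x v df fx.
by congr is_derive; apply/funext => y; rewrite exprfctE.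
Qed.

Lemma is_derive_invf {x v} {f : V -> K} {df} : f x != 0 ->
  is_derive x v f df -> is_derive x v (fun y => (f y)^-1) (- f x ^- 2 * df).
Proof.
by move=> fx0 [f1 <-]; apply: DeriveDef; [exact: derivableV|rewrite deriveV].
Qed.

Lemma is_derive_constf {W : normedModType K} {x v} {a : W} :
  is_derive x v (fun=> a) 0.
Proof. exact: is_derive_cst. Qed.

Lemma is_derive_idf {x v} : is_derive x v (fun y => y) v.
Proof. exact: is_derive_id. Qed.

End DirectionalDerivative.

(* [is_derive_expf] precedes [is_derive_mulf], because unification would otherwise
   unfold a concrete power to a product. *)
Ltac differentiate :=
  repeat first
    [ eapply is_derive_idf | eapply is_derive_constf | eapply is_derive_triple
    | eapply is_derive_fst | eapply is_derive_snd | eapply is_derive_addf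
    | eapply is_derive_oppf | eapply is_derive_expf | eapply is_derive_mulf
    | eapply is_derive_invf ].

Section Limit.
Context {K : numFieldType} {x : K * K * K}.
Implicit Types (f g : K * K * K -> K) (a b c : K).

Lemma cvg_fst_fst {a b c} : y.1.1 @[y --> nbhs (a, b, c)] --> a.
Proof. by apply: cvg_comp; exact: cvg_fst. Qed.

Lemma cvg_snd_fst {a b c} : y.1.2 @[y --> nbhs (a, b, c)] --> b.
Proof. by apply: cvg_comp; [exact: cvg_fst|exact: cvg_snd]. Qed.

Lemma cvg_sndf {a b c} : y.2 @[y --> nbhs (a, b, c)] --> c.
Proof. exact: cvg_snd. Qed.

Lemma cvg_constf {a} : (fun=> a) @ x --> a.
Proof. exact: cvg_cst. Qed.

Lemma cvg_addf {f g a b} :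
  f @ x --> a -> g @ x --> b -> f y + g y @[y --> x] --> a + b.
Proof. exact: cvgD. Qed.

Lemma cvg_oppf {f a} : f @ x --> a -> - f y @[y --> x] --> - a.
Proof. exact: cvgN. Qed.

Lemma cvg_mulf {f g a b} :
  f @ x --> a -> g @ x --> b -> f y * g y @[y --> x] --> a * b.
Proof. exact: cvgM. Qed.

Lemma cvg_expf {f a} {n : nat} :
  f @ x --> a -> f y ^+ n @[y --> x] --> a ^+ n.
Proof.
move=> fa; elim: n => [|n IHn]; first exact: cvg_cst.
rewrite exprS; under eq_fun do rewrite exprS.
exact: cvgM.
Qed.

Lemma cvg_invf {f a} : a != 0 -> f @ x --> a -> (f y)^-1 @[y --> x] --> a^-1.
Proof. exact: cvgV. Qed.

Lemma cvg_triple {f g h : K * K * K -> K} {a b c} :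
  f @ x --> a -> g @ x --> b -> h @ x --> c ->
  (f y, g y, h y) @[y --> x] --> (a, b, c).
Proof.
move=> fa gb hc; apply: (@cvg_pair _ _ _ (nbhs x) (nbhs (a, b)) (nbhs c)) => //.
exact: (@cvg_pair _ _ _ (nbhs x) (nbhs a) (nbhs b)).
Qed.

End Limit.

(** The limit may be an existential variable: it is assembled along the syntax of the function. The
    nonvanishing of denominators is left as side goals. *)
Ltac take_limit :=
  repeat lazymatch goal with
  | |- context [@fmap _ _ ?f _] =>
    lazymatch f with
    | fun=> ?c => eapply cvg_constf
    | fun y => (@?g y, @?h y, @?k y) => eapply cvg_triple
    | fun y => @?g y + @?h y => eapply cvg_addf
    | fun y => - @?g y => eapply cvg_oppf
    | fun y => @?g y * @?h y => eapply cvg_mulf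
    | fun y => @?g y ^+ _ => eapply cvg_expf
    | fun y => (@?g y)^-1 => eapply cvg_invf
    | fun y => y.1.1 => eapply cvg_fst_fst
    | fun y => y.1.2 => eapply cvg_snd_fst
    | snd => eapply cvg_sndf
    end
  end.

Section Restriction.
Variables (K : numFieldType) (k0 k1 koo : K).

Lemma XVE t q p : t != 0 -> XV k0 k1 koo (t, q, p) =
  (1,
   (2 * q * (q - 1) ^+ 2 * p
    - (k0 * (q - 1) ^+ 2 + (k1 - 1) * q * (q - 1) - t * q)) / t,
   - (((q - 1) ^+ 2 + 2 * q * (q - 1)) * p ^+ 2
    - (2 * k0 * (q - 1) + (k1 - 1) * (2 * q - 1) - t) * p
    + rho k0 k1 koo) / t).
Proof.
move=> t0.
(* The derivative rules apply to projections, not to a destructured triple. *)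
have HVE : HV k0 k1 koo = fun x => (x.1.2 * (x.1.2 - 1) ^+ 2 * x.2 ^+ 2
   - (k0 * (x.1.2 - 1) ^+ 2 + (k1 - 1) * x.1.2 * (x.1.2 - 1) - x.1.1 * x.1.2)
     * x.2
   + rho k0 k1 koo * (x.1.2 - 1)) / x.1.1.
  by apply/funext => -[[]].
rewrite /XV; congr (_, _, _).
- apply: derive_val; rewrite HVE; eapply is_derive_eq; first by differentiate.
  by move=> /=; field.
- rewrite mulNr; congr (- _).
  apply: derive_val; rewrite HVE; eapply is_derive_eq; first by differentiate.
  by move=> /=; field.
Qed.

(** On the chart, [s] is the logarithmic derivative of q~ along t X^V. *)
Definition XV_A_ext y : K * K * K :=
  let s := 2 * y.2 - k0 * y.1.2 - (k1 - 1) * (y.1.2 + 1)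
           + y.1.1 * (y.1.2 + 1) in
  (- y.1.1 + y.1.1 * s, - (y.1.2 * s),
   y.2 ^+ 2 * (y.1.2 + 2 * (y.1.2 + 1)) / (y.1.2 + 1)
   - (2 * k0 * y.1.2 + (k1 - 1) * (2 * y.1.2 + 1) - y.1.1 * y.1.2) * y.2
   + rho k0 k1 koo * (y.1.2 + 1) * y.1.2
   - (2 * y.1.2 + 1) * y.2 * s / (y.1.2 + 1)).

(** On the chart, [s] is the derivative of q along X^V; the factor t has cancelled. *)
Definition XV_a_ext y : K * K * K :=
  let q := y.1.2 * y.1.1 + 1 in
  let s := 2 * q * y.2 - k0 * y.1.2 ^+ 2 * y.1.1 - (k1 - 1) * q * y.1.2 + q in
  (y.1.2 * y.1.1, y.1.2 * s - y.1.2 ^+ 2,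
   - ((y.1.2 * y.1.1 + 2 * q) * y.2 ^+ 2)
   + y.1.2 * (2 * k0 * y.1.2 * y.1.1 + (k1 - 1) * (2 * q - 1) - y.1.1) * y.2
   - rho k0 k1 koo * y.1.2 ^+ 3 * y.1.1 + 2 * y.2 * s - y.1.2 * y.2).

Lemma scale_triple (c u v w : K) : c *: (u, v, w) = (c * u, c * v, c * w).
Proof. by []. Qed.

Lemma XV_AE y : chartA_dom y -> XV_A k0 k1 koo y = XV_A_ext y.
Proof.
case: y => [[A q] P] [A0 q0 q10].
have chartAE : @chartA K = fun x => (x.1.1 / (x.1.2 - 1), x.1.2 - 1,
    x.2 * x.1.2 * (x.1.2 - 1)) by apply/funext => -[[]].
rewrite /XV_A /in_coords [chartA_inv _]/= XVE ?mulf_neq0// chartAE scale_triple.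
apply: derive_val; eapply is_derive_eq; first differentiate.
  (* The side condition is that q - 1 does not vanish at q = q~ + 1. *)
  by rewrite /= addrK.
by rewrite /XV_A_ext /=; congr (_, _, _); field; rewrite ?addrK q0 A0 q10.
Qed.

Lemma XV_aE y : charta_dom y -> XV_a k0 k1 koo y = XV_a_ext y.
Proof.
case: y => [[t a] P] [t0 a0].
have chartaE : @charta K = fun x => (x.1.1, (x.1.2 - 1) / x.1.1,
    x.2 * (x.1.2 - 1) ^+ 2 / x.1.1) by apply/funext => -[[]].
rewrite /XV_a /in_coords [charta_inv _]/= XVE// chartaE scale_triple.
apply: derive_val; eapply is_derive_eq; first by differentiate.
by rewrite /XV_a_ext /=; congr (_, _, _); field; rewrite ?t0 ?a0.
Qed.

(** A full limit of [G] restricts to [dom], where [F] agrees with it. Keeping [w] apart from [v]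
    lets the limit be computed first and simplified afterwards. *)
Lemma boundary_limit_ext (dom : set (K * K * K))
    (F G : K * K * K -> K * K * K) (b v w : K * K * K) :
  (forall y, dom y -> F y = G y) -> G @ b --> w -> w = v ->
  boundary_limit dom F b v.
Proof.
move=> FG Gw <-.
have : {near within dom (nbhs b), G =1 F}.
  by apply: (filterS _ (@filterT _ (nbhs b) _)) => y _ /FG.
by move=> /near_eq_cvg /cvg_trans; apply; exact: cvg_within_filter.
Qed.

(** Every term in [k0] or [rho] carries a factor q~ and vanishes in the limit, where [s] becomes A +
    2 P - k1 + 1; the terms in P^2 cancel in the last component. *)
Lemma restriction_A : is_restriction_A k0 k1 koo (XB_A k1).
Proof.
move=> A P; eapply boundary_limit_ext; [exact: XV_AE|unfold XV_A_ext; cbv zeta|].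
  (* The denominator q~ + 1 tends to 1. *)
  by take_limit; rewrite add0r oner_eq0.
by rewrite /= add0r; congr (_, _, _); field.
Qed.

(** Here the terms in [k0] and [rho] carry a factor t, and q tends to 1. *)
Lemma restriction_a : is_restriction_a k0 k1 koo (XB_a k1).
Proof.
move=> a P; eapply boundary_limit_ext; [exact: XV_aE|unfold XV_a_ext; cbv zeta|].
  by take_limit.
by rewrite /=; congr (_, _, _); ring.
Qed.

(** With f the spectral datum, the field is A/4 times the planar Hamiltonian field (f_P, - f_A),
    which annihilates f. *)
Lemma first_integral_A : first_integral setT (XB_A k1) (spectral_A k1).
Proof.
move=> [A P] _.
have -> : spectral_A k1 = fun z =>
    (k1 + 1) ^+ 2 + 4 * z.2 * (z.1 + z.2 - k1) by apply/funext => -[].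
by eapply is_derive_eq; [differentiate|rewrite /=; ring].
Qed.

(** Likewise the field is a^3/4 times (f_P, - f_a), where f has a pole along a = 0. *)
Lemma first_integral_a :
  first_integral [set z | z.1 != 0] (XB_a k1) (spectral_a k1).
Proof.
move=> [a P] /= a0.
have -> : spectral_a k1 = fun z => (k1 + 1) ^+ 2 - 4 * z.2 * k1 / z.1
    + 4 * z.2 * (z.2 + 1) / z.1 ^+ 2 by apply/funext => -[].
by eapply is_derive_eq; [differentiate; rewrite ?expf_neq0|rewrite /=; field].
Qed.

End Restriction.

Theorem proposition2p2 (R : realType) (kappa0 kappa1 kappa_inf : R[i]) :
  [/\ is_restriction_A kappa0 kappa1 kappa_inf (XB_A kappa1),
      is_restriction_a kappa0 kappa1 kappa_inf (XB_a kappa1),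
      first_integral setT (XB_A kappa1) (spectral_A kappa1)
    & first_integral [set z | z.1 != 0] (XB_a kappa1) (spectral_a kappa1)].
Proof.
split; [exact: restriction_A|exact: restriction_a|exact: first_integral_A|].
exact: first_integral_a.
Qed.
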